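(* Let $p,q\ge 1$ be integers with $p+q=n$. Let $X_1,\ldots,X_n$ be independent random variables such that $X_i\sim W(\alpha,\lambda_1)$ for $i=1,\ldots,p$ and $X_j\sim W(\alpha,\lambda)$ for $j=p+1,\ldots,n$, with $\lambda_1,\lambda>0$. Let $Y_1,\ldots,Y_n$ be independent nonnegative random variables with $Y_i\sim W(\alpha,\lambda_1^{*})$ for $i=1,\ldots,p$ and $Y_j\sim W(\alpha,\lambda)$ for $j=p+1,\ldots,n$, with $\lambda_1^{*},\lambda>0$. Let $X_{n:n}=\max(X_1,\ldots,X_n)$ and $Y_{n:n}=\max(Y_1,\ldots,Y_n)$. Suppose $\lambda_1^{*}=\min(\lambda,\lambda_1,\lambda_1^{*})$. Then, for any $\alpha>0$, $$(\underbrace{\lambda_1,\ldots,\lambda_1}_{p},\underbrace{\lambda,\ldots,\lambda}_{q})\preceq^{w}(\underbrace{\lambda_1^{*},\ldots,\lambda_1^{*}}_{p},\underbrace{\lambda,\ldots,\lambda}_{q})\ \Rightarrow\ X_{n:n}\le_{lr}Y_{n:n}.$$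
   Context: Weibull distribution: $X\sim W(\alpha,\lambda)$ (shape $\alpha>0$, parameter $\lambda>0$) means $X$ has density $f(t)=\alpha\lambda(\lambda t)^{\alpha-1}e^{-(\lambda t)^{\alpha}}$ for $t>0$, i.e. distribution function $1-e^{-(\lambda t)^{\alpha}}$ for $t>0$. ''Increasing'' means non-decreasing. Weak majorization: for $x,y\in\mathbb{R}^n$ with increasing arrangements $x_{(1)}\le\cdots\le x_{(n)}$ and $y_{(1)}\le\cdots\le y_{(n)}$, $x\preceq^{w}y$ means $\sum_{i=1}^{j}x_{(i)}\ge\sum_{i=1}^{j}y_{(i)}$ for all $j=1,\ldots,n$. Likelihood ratio order: for random variables $X,Y$ with densities $f,g$, $X\le_{lr}Y$ means that $g(t)/f(t)$ is increasing in $t$ over all $t$ for which the ratio is well defined (here, $t>0$). *)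

(* Defs.v *)
From HB Require Import structures.
From mathcomp Require Import all_boot all_order all_algebra.
From mathcomp Require Import all_classical all_reals all_analysis.

Set Implicit Arguments.
Unset Strict Implicit.
Unset Printing Implicit Defensive.

Import Order.TTheory GRing.Theory Num.Theory.

Local Open Scope classical_set_scope.
Local Open Scope ring_scope.

Section random_variables.
Context (R : realType) (d : measure_display) (T : measurableType d)
  (P : probability T R).

Definition has_density (X : T -> R) (f : R -> R) : Prop :=
  [/\ measurable_fun setT X,
      measurable_fun setT f,
      (forall t, 0 <= f t) &
      forall A : set R, measurable A ->
        P (X @^-1` A) = (\int[lebesgue_measure]_(t in A) (f t)%:E)%E].

Definition mutually_independent (I : finType) (X : I -> T -> R) : Prop :=
  forall (J : {set I}) (B : I -> set R), (forall i, measurable (B i)) ->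
    P (\bigcap_(i in [set` J]) (X i @^-1` B i)) =
    (\prod_(i in J) P (X i @^-1` B i))%E.

End random_variables.

Definition weibull_pdf (R : realType) (alpha lambda t : R) : R :=
  if 0 < t then
    alpha * lambda * (lambda * t) `^ (alpha - 1) *
      expR (- ((lambda * t) `^ alpha))
  else 0.

Definition weibull (R : realType) (d : measure_display) (T : measurableType d)
    (P : probability T R) (X : T -> R) (alpha lambda : R) : Prop :=
  has_density P X (weibull_pdf alpha lambda).

(* The neutral value is an entry of x as soon as 0 < n, so that it does not
   affect the maximum (with neutral value 0, negative families would be
   truncated). *)
Definition vmax (R : realType) (n : nat) (x : 'I_n -> R) : R :=
  \big[Num.max/head 0 (codom x)]_(i < n) x i.

Definition increasing_arrangement (R : realType) (n : nat) (x : 'rV[R]_n) :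
    seq R :=
  sort <=%R [seq x 0 i | i <- enum 'I_n].

(* x_(i) of the literature is (increasing_arrangement x)`_i.-1; for x, y in R^n
   weak_majorized x y reads x <=^w y. *)
Definition weak_majorized (R : realType) (n : nat) (x y : 'rV[R]_n) : Prop :=
  forall j : nat, (1 <= j <= n)%N ->
    \sum_(i < j) (increasing_arrangement x)`_i >=
    \sum_(i < j) (increasing_arrangement y)`_i.

(* The ratio g t / f t is taken in \bar R, where a / 0 = +oo for 0 < a, so it
   is undefined only when f t = g t = 0.  Densities are unique only up to null
   sets, whence the existential quantification over versions.  D is the exact
   set on which the ratio is well defined. *)
Definition lr_le (R : realType) (D : set R)
    (d : measure_display) (T : measurableType d) (P : probability T R)
    (X : T -> R)
    (d' : measure_display) (T' : measurableType d') (P' : probability T' R)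
    (Y : T' -> R) : Prop :=
  exists f g : R -> R,
    [/\ has_density P X f,
        has_density P' Y g,
        D = [set t | f t != 0 \/ g t != 0] &
        forall s t : R, D s -> D t -> s <= t ->
          ((g s)%:E / (f s)%:E <= (g t)%:E / (f t)%:E)%E].

(* Main.v *)
(** The minimality of [lambda1s] gives [c <= a] and [c <= b] for
    [a = lambda1 ^ alpha], [b = lambda ^ alpha], [c = lambda1s ^ alpha].  In the
    variable [u = t ^ alpha], with [r_l u = l / (exp (l u) - 1)], the densities
    of the two maxima have the ratio
      [((1 - exp (- c u)) / (1 - exp (- a u))) ^ p
         * (p r_c + q r_b) / (p r_a + q r_b)].
    The first factor is increasing by convexity of [x ^ (a / c)]; so are
    [r_c / r_a] and [r_c / r_b], and with [r_a <= r_c] this makes the second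
    factor increasing.  The density of a maximum is identified through its tails
    on [[a, +oo[] with [0 < a], where it is continuous even if [alpha < 1]. *)
Require Import Defs.
From HB Require Import structures.
From mathcomp Require Import all_boot all_order all_algebra.
From mathcomp Require Import all_classical all_reals all_analysis.
From mathcomp Require Import measurable_realfun ring lra.

Import Order.TTheory GRing.Theory Num.Theory.
Import numFieldNormedType.Exports.

Set Implicit Arguments.
Unset Strict Implicit.
Unset Printing Implicit Defensive.

Local Open Scope classical_set_scope.
Local Open Scope ring_scope.

(** * Convexity inequalities for powers and exponentials *)

Section exponential_inequalities.
Context {R : realType}.
Implicit Types (a c s t u x y k th : R).

(** The point [x] sits at parameter [th] on the segment from [1] to [y], so this is convexity of the
    power with exponent [k]. Measuring everything from [1] lets it serve for [y] on either side of
    [1]. *)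
Lemma powR_chord k x y th : 1 <= k -> 0 <= y -> 0 <= th <= 1 ->
  x - 1 = th * (y - 1) -> x `^ k - 1 <= th * (y `^ k - 1).
Proof.
move=> k1 y0 /andP[th0 th1] xE.
have := convex_powR k1 (Itv01 th0 th1) (x := y) (y := 1).
rewrite !inE/= !in_itv/= !andbT => /(_ y0 ler01).
rewrite [X in X `^ _]convRE [X in _ <= X]convRE/= /unstable.onem powR1 !mulr1.
have -> : th * y + (1 - th) = x by lra.
lra.
Qed.

(** Chord slopes from the point [1] increase; the chord parameter is [(x - 1) / (y - 1)]. *)
Lemma powR_slope k x y : 1 <= k -> 1 < x -> x <= y ->
  (x `^ k - 1) * (y - 1) <= (y `^ k - 1) * (x - 1).
Proof.
move=> k1 x1 xy; have y1 : 0 < y - 1 by lra.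
rewrite -ler_pdivlMr// -mulrA mulrC.
apply: powR_chord => //; first lra.
- by rewrite divr_ge0 ?ler_pdivrMr//=; lra.
- by rewrite divfK// gt_eqF.
Qed.

(** Mirror image to the left of [1], with chord parameter [(1 - x) / (1 - y)]. *)
Lemma powR_slope_lt1 k x y : 1 <= k -> 0 <= y -> y <= x -> x < 1 ->
  (1 - x) * (1 - y `^ k) <= (1 - y) * (1 - x `^ k).
Proof.
move=> k1 y0 yx x1; have y1 : 0 < 1 - y by lra.
rewrite -ler_pdivrMl// mulrA [_^-1 * _]mulrC -lerN2 -mulrN !opprB.
apply: powR_chord => //.
- by rewrite divr_ge0 ?ler_pdivrMr//=; lra.
- by rewrite -[y - 1]opprB mulrN divfK ?opprB// gt_eqF.
Qed.

(** Writes the exponential of rate [a] as a power of the one of rate [c]; the exponent [a / c] is at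
    least [1] when [c <= a], as the power inequalities demand. *)
Lemma expR_powR_div a c u : 0 < c -> expR (a * u) = expR (c * u) `^ (a / c).
Proof.
by move=> c0; rewrite -expRM mulrAC [a / c]mulrC mulrA mulfV ?mul1r ?gt_eqF// mulrC.
Qed.

Lemma expRB1_slope a c s t : 0 < c -> c <= a -> 0 < s -> s <= t ->
  (expR (a * s) - 1) * (expR (c * t) - 1) <=
  (expR (a * t) - 1) * (expR (c * s) - 1).
Proof.
move=> c0 ca s0 st; rewrite !(expR_powR_div a _ c0)//.
apply: powR_slope; first by rewrite ler_pdivlMr// mul1r.
- by rewrite expR_gt1 mulr_gt0.
- by rewrite ler_expR ler_pM2l.
Qed.

(** The bases [expR (- (c * s))] and [expR (- (c * t))] lie below [1] and decrease in the abscissa,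
    hence the slope inequality to the left of [1]. *)
Lemma onem_expRN_slope a c s t : 0 < c -> c <= a -> 0 < s -> s <= t ->
  (1 - expR (- (c * s))) * (1 - expR (- (a * t))) <=
  (1 - expR (- (c * t))) * (1 - expR (- (a * s))).
Proof.
move=> c0 ca s0 st.
have E u : expR (- (a * u)) = expR (- (c * u)) `^ (a / c).
  by rewrite -mulrN (expR_powR_div a _ c0) mulrN.
rewrite (E s) (E t).
apply: powR_slope_lt1; first by rewrite ler_pdivlMr// mul1r.
- exact: expR_ge0.
- by rewrite ler_expR lerN2 ler_pM2l.
- by rewrite expR_lt1 oppr_lt0 mulr_gt0.
Qed.

(** Convexity of the exponential between [0] and [a * u], with weight [c / a] on the latter. *)
Lemma expRB1_chord a c u : 0 < c -> c <= a ->
  a * (expR (c * u) - 1) <= c * (expR (a * u) - 1).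
Proof.
move=> c0 ca; have a0 : 0 < a by lra.
have th0 : 0 <= c / a by rewrite divr_ge0 // ltW.
have th1 : c / a <= 1 by rewrite ler_pdivrMr ?mul1r.
have := convex_expR (Itv01 th0 th1) (a * u) 0.
rewrite [X in expR X]convRE [X in _ <= X]convRE/= /unstable.onem expR0 mulr0 addr0 mulr1.
rewrite mulrA divfK ?gt_eqF// => h.
have E : a * (c / a) = c by rewrite mulrC divfK ?gt_eqF.
rewrite -(ler_pM2l a0) mulrDr mulrA E mulrBr E mulr1 in h.
lra.
Qed.

End exponential_inequalities.

(** * Ratios of mixtures of exponential odds *)

Section two_rates.
Context {R : realType}.
Implicit Types (a b c s t u P Q x y z : R).

(** The reversed hazard rate, density over distribution function, of the exponential law of rate
    [a]. *)
Definition exp_odds a u := a / (expR (a * u) - 1).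

Lemma expRB1_gt0 a u : 0 < a -> 0 < u -> 0 < expR (a * u) - 1.
Proof. by move=> a0 u0; rewrite subr_gt0 expR_gt1 mulr_gt0. Qed.

Lemma exp_odds_gt0 a u : 0 < a -> 0 < u -> 0 < exp_odds a u.
Proof. by move=> a0 u0; rewrite divr_gt0// expRB1_gt0. Qed.

Lemma exp_odds_le a c u : 0 < c -> c <= a -> 0 < u ->
  exp_odds a u <= exp_odds c u.
Proof.
move=> c0 ca u0; have a0 : 0 < a by lra.
rewrite /exp_odds ler_pdivrMr ?expRB1_gt0// mulrAC ler_pdivlMr ?expRB1_gt0//.
exact: expRB1_chord.
Qed.

Lemma exp_odds_ratio a c s t : 0 < c -> c <= a -> 0 < s -> s <= t ->
  exp_odds c s * exp_odds a t <= exp_odds c t * exp_odds a s.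
Proof.
move=> c0 ca s0 st; have a0 : 0 < a by lra.
have t0 : 0 < t by lra.
rewrite /exp_odds !mulf_div ler_pM2l ?mulr_gt0//.
rewrite lef_pV2 ?posrE ?mulr_gt0 ?expRB1_gt0//.
by rewrite mulrC [leRHS]mulrC expRB1_slope.
Qed.

(* With [x], [y], [z] standing for the odds of the rates [c], [a], [b] and the
   second letter for the abscissa: no comparison of [a] and [b] is required. *)
Lemma mixed_ratio P Q xs xt ys yt zs zt : 0 <= P -> 0 <= Q ->
  0 < ys -> ys <= xs -> xs * yt <= xt * ys -> xs * zt <= xt * zs ->
  0 <= zs ->
  (P * xs + Q * zs) * (P * yt + Q * zt) <= (P * xt + Q * zt) * (P * ys + Q * zs).
Proof.
move=> P0 Q0 ys0 yx xy xz zs0.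
have xs0 : 0 < xs by lra.
(* This is the coefficient of [P * Q] in the difference of the two sides, where the [Q * Q] terms
   cancel. Multiplied by [xs], it becomes [zs * (xt * ys - xs * yt) + (xs - ys) * (xt * zs - xs *
   zt)]. *)
have cross : xs * zt + zs * yt <= xt * zs + zt * ys.
  rewrite -(ler_pM2l xs0).
  have h1 := ler_wpM2l zs0 xy.
  have h2 : 0 <= (xs - ys) * (xt * zs - xs * zt).
    by rewrite mulr_ge0// subr_ge0.
  nra.
have h1 : 0 <= P * P * (xt * ys - xs * yt).
  by rewrite !mulr_ge0// subr_ge0.
have h2 : 0 <= P * Q * (xt * zs + zt * ys - (xs * zt + zs * yt)).
  by rewrite !mulr_ge0// subr_ge0.
nra.
Qed.

Lemma exp_odds_mix_ratio p q a b c s t :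
  0 < c -> c <= a -> c <= b -> 0 < s -> s <= t ->
  (p%:R * exp_odds c s + q%:R * exp_odds b s) *
    (p%:R * exp_odds a t + q%:R * exp_odds b t) <=
  (p%:R * exp_odds c t + q%:R * exp_odds b t) *
    (p%:R * exp_odds a s + q%:R * exp_odds b s).
Proof.
move=> c0 ca cb s0 st.
have [a0 b0] : 0 < a /\ 0 < b by split; lra.
by apply: mixed_ratio; rewrite ?ler0n ?exp_odds_gt0 ?exp_odds_le
  ?exp_odds_ratio ?(ltW (exp_odds_gt0 _ _)).
Qed.

End two_rates.

(** * The Weibull distribution function and density *)

Section weibull_cdf.
Context {R : realType}.
Implicit Types (alpha lambda t : R).

(** For negative [t] the power takes a default value, so the formula is meant as the distribution
    function on the positive half-line. *)
Definition weibull_cdf alpha lambda t := 1 - expR (- ((lambda * t) `^ alpha)).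

Lemma powR_cvgy alpha : 0 < alpha -> t `^ alpha @[t --> +oo] --> +oo.
Proof.
move=> a0; apply/cvgryPge => A; near=> t.
(* The threshold inverts the power; the absolute value covers a negative [A]. *)
have h : `|A| `^ alpha^-1 <= t.
  by near: t; apply: nbhs_pinfty_ge; exact: num_real.
apply: (le_trans (ler_norm A)).
rewrite -[leLHS]powRr1// -(mulVf (lt0r_neq0 a0)) powRrM.
by rewrite ge0_ler_powR ?nnegrE ?powR_ge0 ?(ltW a0)// (le_trans _ h) ?powR_ge0.
Unshelve. all: by end_near. Qed.

Lemma is_derive_powR_scale alpha lambda t : 0 < lambda -> 0 < t ->
  is_derive t 1 (fun x => (lambda * x) `^ alpha)
    (alpha * (lambda * t) `^ (alpha - 1) * lambda).
Proof.
move=> l0 t0; have D : is_derive t 1 ( *%R lambda) lambda.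
  by apply: is_derive_eq; rewrite ?scaler1.
exact: is_derive1_comp (is_derive1_powR alpha (mulr_gt0 l0 t0)) D.
Qed.

Lemma is_derive_weibull_cdf alpha lambda t : 0 < lambda -> 0 < t ->
  is_derive t 1 (weibull_cdf alpha lambda) (weibull_pdf alpha lambda t).
Proof.
move=> l0 t0; rewrite /weibull_pdf t0.
have D := is_derive1_comp (is_derive_expR _)
  (is_deriveN (is_derive_powR_scale alpha l0 t0)).
apply: is_derive_eq (is_deriveB (is_derive_cst (1 : R) t (1 : R)) D) _.
by rewrite /= sub0r /GRing.scale/=; ring.
Qed.

Lemma weibull_pdf_ge0 alpha lambda t : 0 < alpha -> 0 < lambda ->
  0 <= weibull_pdf alpha lambda t.
Proof.
move=> a0 l0; rewrite /weibull_pdf; case: ifP => // t0.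
by rewrite !mulr_ge0 ?expR_ge0 ?powR_ge0// ltW.
Qed.

Lemma weibull_cdf_ge0 alpha lambda t : 0 <= weibull_cdf alpha lambda t.
Proof. by rewrite subr_ge0 -[leRHS]expR0 ler_expR oppr_le0 powR_ge0. Qed.

Lemma weibull_cdf_cvg1 alpha lambda : 0 < alpha -> 0 < lambda ->
  weibull_cdf alpha lambda t @[t --> +oo] --> (1 : R).
Proof.
move=> a0 l0; rewrite -[X in _ --> X]subr0.
apply: cvgB; first exact: cvg_cst.
have h : (lambda * t) `^ alpha @[t --> +oo] --> +oo.
  have h1 : lambda * t @[t --> +oo] --> +oo by exact: gt0_cvgMry.
  exact: (cvg_comp _ _ h1 (powR_cvgy a0)).
exact: (cvg_comp _ _ h (@cvgr_expR R)).
Qed.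

Lemma continuous_weibull_cdf alpha lambda : 0 < lambda ->
  {in `]0, +oo[, continuous (weibull_cdf alpha lambda)}.
Proof.
move=> l0 t; rewrite in_itv/= andbT => t0.
apply: differentiable_continuous; apply/derivable1_diffP.
by have [] := is_derive_weibull_cdf alpha l0 t0.
Qed.

Lemma continuous_weibull_pdf alpha lambda : 0 < lambda ->
  {in `]0, +oo[, continuous (weibull_pdf alpha lambda)}.
Proof.
move=> l0 t; rewrite in_itv/= andbT => t0.
(* [g] is the positive branch of the density; it agrees with the density near [t], so continuity
   transfers. *)
pose g (x : R) := alpha * lambda * (lambda * x) `^ (alpha - 1) *
                   expR (- ((lambda * x) `^ alpha)).
have gE : \forall x \near t, g x = weibull_pdf alpha lambda x.
  by near=> x; rewrite /weibull_pdf ifT//; near: x; exact: lt_nbhsr.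
have gt : g t = weibull_pdf alpha lambda t by rewrite /weibull_pdf t0.
rewrite /continuous_at -gt; apply: cvg_trans; first exact: (near_eq_cvg gE).
have pc b : {for t, continuous (fun x => (lambda * x) `^ b)}.
  apply: differentiable_continuous; apply/derivable1_diffP.
  by have [] := is_derive_powR_scale b l0 t0.
apply: cvgM; first by apply: cvgM; [exact: cvg_cst|exact: pc].
by apply: cvg_comp; [apply: cvgN; exact: pc|exact: continuous_expR].
Unshelve. all: by end_near. Qed.

Lemma measurable_weibull_cdf alpha lambda :
  measurable_fun setT (weibull_cdf alpha lambda).
Proof.
apply: measurable_funB => //; apply: measurableT_comp => //.
apply: measurableT_comp => //.
by apply: (measurableT_comp (measurable_powR alpha)); exact: mulrl_measurable.
Qed.

Lemma measurable_weibull_pdf alpha lambda :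
  measurable_fun setT (weibull_pdf alpha lambda).
Proof.
apply: measurable_fun_if => //; first exact: measurable_fun_ltr.
apply: measurable_funTS; apply: measurable_funM.
  apply: measurable_funM => //.
  by apply: (measurableT_comp (measurable_powR _)); exact: mulrl_measurable.
apply: measurableT_comp => //.
apply: measurableT_comp => //.
by apply: (measurableT_comp (measurable_powR alpha)); exact: mulrl_measurable.
Qed.

Lemma weibull_cdfE alpha lambda t : 0 < lambda -> 0 < t ->
  weibull_cdf alpha lambda t = 1 - expR (- (lambda `^ alpha * t `^ alpha)).
Proof. by move=> l0 t0; rewrite /weibull_cdf powRM// ltW. Qed.

Lemma weibull_cdf_gt0 alpha lambda t : 0 < lambda -> 0 < t ->
  0 < weibull_cdf alpha lambda t.
Proof.
move=> l0 t0; rewrite weibull_cdfE// subr_gt0 expR_lt1 oppr_lt0.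
by rewrite mulr_gt0 ?powR_gt0.
Qed.

(** In the variable [t ^ alpha] the Weibull law is exponential of rate [lambda ^ alpha]: the first
    two factors are the derivative of that change of variable, the last two the distribution
    function and the reversed hazard rate. *)
Lemma weibull_pdf_odds alpha lambda t : 0 < alpha -> 0 < lambda -> 0 < t ->
  weibull_pdf alpha lambda t =
  alpha * t `^ (alpha - 1) * weibull_cdf alpha lambda t *
    exp_odds (lambda `^ alpha) (t `^ alpha).
Proof.
move=> a0 l0 t0; rewrite /weibull_pdf t0 weibull_cdfE// !powRM ?(ltW l0) ?(ltW t0)//.
have la0 : 0 < lambda `^ alpha by rewrite powR_gt0.
have ta0 : 0 < t `^ alpha by rewrite powR_gt0.
have lE : lambda * lambda `^ (alpha - 1) = lambda `^ alpha.
  rewrite -{1}[lambda]powRr1 ?(ltW l0)// -powRD ?(gt_eqF l0) ?implybT//.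
  by rewrite addrCA subrr addr0.
have E0 := expRB1_gt0 la0 ta0.
rewrite /exp_odds expRN -lE; rewrite -lE in la0 E0.
have := expR_gt0 (lambda * lambda `^ (alpha - 1) * t `^ alpha).
move: (expR _) E0 => E E1 E0.
by field; rewrite !gt_eqF.
Qed.

Lemma weibull_pdf_le0 alpha lambda t : t <= 0 -> weibull_pdf alpha lambda t = 0.
Proof. by move=> t0; rewrite /weibull_pdf ltNge t0. Qed.

End weibull_cdf.

(** * The measure defined by a density *)

Section density_measure.
Context {R : realType} (f : R -> R).
Hypotheses (f0 : forall t, 0 <= f t) (mf : measurable_fun setT f).
Local Open Scope ereal_scope.

(* The two proofs are phantom arguments: the measure instance is keyed on them. *)
Definition density_measure (_ : forall t, (0 <= f t)%R)
    (_ : measurable_fun setT f) (A : set R) : \bar R :=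
  \int[lebesgue_measure]_(t in A) (f t)%:E.

Let nu := density_measure f0 mf.

Let nu0 : nu set0 = 0.
Proof. exact: integral_set0. Qed.

Let nu_ge0 A : 0 <= nu A.
Proof. by apply: integral_ge0 => t _; rewrite lee_fin. Qed.

Let nu_sigma_additive : semi_sigma_additive nu.
Proof.
move=> F mF tF mUF; rewrite /nu/density_measure; apply: cvg_toP.
  apply: ereal_nondecreasing_is_cvgn => m n mn.
  by apply: lee_sum_nneg_natr => // k _ _; exact: nu_ge0.
rewrite ge0_integral_bigcup//=.
- exact/measurable_funTS/measurable_EFinP.
- by move=> t _; rewrite lee_fin.
Qed.

HB.instance Definition _ := isMeasure.Build _ _ _
  nu nu0 nu_ge0 nu_sigma_additive.

End density_measure.

(** * Laws on the positive half-line determined by their tails *)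

Section positive_random_variable.
Context {R : realType}.

Lemma itvoy0_bigcup :
  `]0%R, +oo[%classic = \bigcup_n `[(n.+1%:R^-1 : R), +oo[%classic.
Proof.
rewrite itvoyEbigcup; apply: eq_bigcupr => n _.
by rewrite add0r.
Qed.

Lemma measure_Ici_le0 (m : {measure set R -> \bar R}) (a : R) :
  m `]-oo, 0]%classic = 0%E -> a <= 0 ->
  m `[a, +oo[%classic = m `]0, +oo[%classic.
Proof.
move=> m0 a0.
have -> : `[a, +oo[%classic = `[a, 0]%classic `|` `]0, +oo[%classic.
  by rewrite -itv_bndbnd_setU// bnd_simp.
rewrite measureU//; last first.
  rewrite -subset0 => x /=; rewrite !in_itv/= andbT => -[/andP[_ x0] x1].
  by move: (le_lt_trans x0 x1); rewrite ltxx.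
rewrite -[RHS]add0e; congr (_ + _)%E.
apply/eqP; rewrite eq_le measure_ge0 andbT -m0.
by apply: le_measure; rewrite ?inE//; exact: subset_itvr.
Qed.

(** The rays [[a, +oo[] form a generating class stable under intersection. Since []-oo, 0]] is null,
    rays with [a <= 0] have the mass of []0, +oo[], itself an increasing union of rays with positive
    endpoint. *)
Lemma measure_Ici_eq (m1 m2 : {measure set R -> \bar R}) :
  m1 `]-oo, 0]%classic = 0%E -> m2 `]-oo, 0]%classic = 0%E ->
  (m1 setT < +oo)%E ->
  (forall a, 0 < a -> m1 `[a, +oo[%classic = m2 `[a, +oo[%classic) ->
  forall A, measurable A -> m1 A = m2 A.
Proof.
move=> m10 m20 m1oo m12.
have m12_0 : m1 `]0, +oo[%classic = m2 `]0, +oo[%classic.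
  have cvg (m : {measure set R -> \bar R}) :
      m `[(n.+1%:R^-1 : R), +oo[%classic @[n --> \oo] --> m `]0, +oo[%classic.
    rewrite itvoy0_bigcup; apply: nondecreasing_cvg_mu => //.
    - exact: bigcup_measurable.
    - move=> i j ij; apply/subsetPset/subset_itvr.
      by rewrite bnd_simp lef_pV2 ?posrE// ler_nat ltnS.
  apply: (cvg_unique _ (cvg m1)) => //.
  rewrite (_ : (fun n => _) = fun n => m2 `[(n.+1%:R^-1 : R), +oo[%classic); first exact: cvg.
  by apply/funext => n; exact: m12.
apply: (measure_unique (@RGenCInfty.G R) (fun n => `[- n%:R, +oo[%classic)).
- exact: RGenCInfty.measurableE.
- move=> _ _ [x ->] [y ->]; exists (Num.max x y).
  apply/seteqP; split => z /=; rewrite !in_itv/= !andbT ge_max.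
    by move=> [-> ->].
  by move=> /andP[].
- by move=> n; exists (- n%:R).
- rewrite -subTset => x _ /=.
  exists (Num.bound x) => //=; rewrite in_itv/= andbT lerNl.
  exact/ltW/unstable.ltrNbound.
- move=> _ [a ->]; have [a0|a0] := ltP 0 a; first exact: m12.
  by rewrite !measure_Ici_le0.
- by move=> n; apply: le_lt_trans m1oo; apply: le_measure; rewrite ?inE.
Qed.

Lemma has_density_of_tail d (T : measurableType d) (P : probability T R)
    (Z : T -> R) (f : R -> R) :
  measurable_fun setT Z -> measurable_fun setT f ->
  (forall t, 0 <= f t) -> (forall t, t <= 0 -> f t = 0) ->
  P (Z @^-1` `]-oo, 0]%classic) = 0%E ->
  (forall a, 0 < a -> P (Z @^-1` `[a, +oo[%classic) =
    (\int[lebesgue_measure]_(t in `[a, +oo[) (f t)%:E)%E) ->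
  has_density P Z f.
Proof.
move=> mZ mf f0 fN PZ0 tail; split => // A mA.
(* The law of [Z] is compared with the measure of density [f]; neither charges []-oo, 0]]. *)
apply: (@measure_Ici_eq (pushforward P Z) (density_measure f0 mf)) => //.
- rewrite /density_measure/=; apply: integral0_eq => t /=.
  by rewrite in_itv/= => /fN ->.
- exact: (le_lt_trans (probability_le1 P measurableT) (ltry 1)).
Qed.

(** For [p = 0] or [q = 0] the truncated predecessor is harmless, since the coefficient [p%:R] or
    [q%:R] vanishes. *)
Lemma is_derive_expM (f g : R -> R) (p q : nat) (t df dg : R) :
  is_derive t 1 f df -> is_derive t 1 g dg ->
  is_derive t 1 (fun x => f x ^+ p * g x ^+ q)
    (p%:R * f t ^+ p.-1 * df * g t ^+ q + q%:R * g t ^+ q.-1 * dg * f t ^+ p).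
Proof.
move=> Df Dg; rewrite (_ : (fun x => _) = f ^+ p * g ^+ q).
  by apply: is_derive_eq; rewrite !fctE /GRing.scale/=; ring.
by apply/funext => x; rewrite !fctE.
Qed.

(** Fundamental theorem of calculus on a half-line. As [a] is interior to []0, +oo[], the one-sided
    continuity at the endpoint follows from the two-sided one. *)
Lemma tail_integral (f F : R -> R) (a : R) :
  0 < a -> (forall t, 0 <= f t) -> {in `]0, +oo[, continuous f} ->
  F t @[t --> +oo] --> (1 : R) ->
  (forall t : R, 0 < t -> is_derive t 1 F (f t)) ->
  (\int[lebesgue_measure]_(t in `[a, +oo[) (f t)%:E = (1 - F a)%:E)%E.
Proof.
move=> a0 f0 cf F1 dF.
rewrite (ge0_continuous_FTC2y (F := F) (l := 1))//.
- apply/continuous_within_itvcyP; split.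
    by move=> x; rewrite in_itv/= andbT => ax; apply: cf; rewrite in_itv/= andbT (lt_trans a0).
  by apply: cvg_at_right_filter; apply: cf; rewrite in_itv/= andbT.
- by move=> x ax; have [] := dF _ (lt_trans a0 ax).
- apply: cvg_at_right_filter; apply: differentiable_continuous.
  by apply/derivable1_diffP; have [] := dF _ a0.
- move=> x; rewrite in_itv/= andbT => ax; rewrite derive1E.
  by have [] := dF _ (lt_trans a0 ax).
Qed.

End positive_random_variable.

(** * Density of the maximum of two independent blocks *)

Section weibull_maximum.
Context {R : realType} {d : measure_display} {T : measurableType d}
  (P : probability T R).

Lemma measurable_preimage (Z : T -> R) (B : set R) :
  measurable_fun setT Z -> measurable B -> measurable (Z @^-1` B).
Proof. by move=> mZ mB; rewrite -[X in measurable X]setTI; exact: mZ. Qed.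

Lemma weibull_le0 (Z : T -> R) alpha lambda :
  weibull P Z alpha lambda -> P (Z @^-1` `]-oo, 0]%classic) = 0%E.
Proof.
move=> [_ _ _ ->//]; apply: integral0_eq => t /=.
by rewrite in_itv/= => t0; rewrite weibull_pdf_le0.
Qed.

(** The open ray is the complement of the closed tail [[a, +oo[], whose mass is given by
    [tail_integral]. *)
Lemma weibull_lt (Z : T -> R) alpha lambda (a : R) :
  0 < alpha -> 0 < lambda -> weibull P Z alpha lambda -> 0 < a ->
  P (Z @^-1` `]-oo, a[%classic) = (weibull_cdf alpha lambda a)%:E.
Proof.
move=> al0 l0 [mZ _ _ PZ] a0.
have -> : Z @^-1` `]-oo, a[%classic = ~` (Z @^-1` `[a, +oo[%classic).
  by rewrite preimage_setC setCitvr.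
rewrite probability_setC; last exact: measurable_preimage.
rewrite PZ// (tail_integral a0 (fun t => weibull_pdf_ge0 t al0 l0)
  (continuous_weibull_pdf l0) (weibull_cdf_cvg1 al0 l0)
  (fun t => is_derive_weibull_cdf alpha l0)).
by rewrite -EFinB opprB addrC subrK.
Qed.

Lemma vmax_lt n (x : 'I_n -> R) (a : R) : (0 < n)%N ->
  (vmax x < a) = [forall i, x i < a].
Proof.
case: n x => // n x _; rewrite /vmax.
apply/idP/forallP => [/bigmax_ltP[_ h] i|h]; first exact: (h i isT).
apply/bigmax_ltP; split=> //.
(* The remaining goal concerns the neutral value of the maximum, which for a nonempty family is its
   first entry. *)
by rewrite codomE enum_ordSl/=.
Qed.

Lemma vmax_preimage n (X : 'I_n -> T -> R) (a : R) : (0 < n)%N ->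
  (fun w => vmax (fun i => X i w)) @^-1` `]-oo, a[%classic =
  \bigcap_(i in [set` [set: 'I_n]%SET]) (X i @^-1` `]-oo, a[%classic).
Proof.
move=> n0; apply/seteqP; split => w /=; rewrite in_itv/= vmax_lt//.
  by move=> /forallP h i _; exact: h.
by move=> h; apply/forallP => i; apply: (h i); rewrite /= finset.in_setT.
Qed.

Lemma measurable_vmax n (X : 'I_n -> T -> R) : (0 < n)%N ->
  (forall i, measurable_fun setT (X i)) ->
  measurable_fun setT (fun w => vmax (fun i => X i w)).
Proof.
move=> n0 mX; apply: (measurability _ (RGenCInfty.measurableE R)).
move=> _ [_ [a ->] <-]; rewrite setTI.
rewrite (_ : _ @^-1` _ = ~` ((fun w => vmax (fun i => X i w)) @^-1` `]-oo, a[%classic)).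
  rewrite vmax_preimage//.
  apply: measurableC; apply: fin_bigcap_measurable => [|i _].
    exact: finite_finset.
  exact: measurable_preimage.
by rewrite preimage_setC setCitvl.
Qed.

(** For positive [t], the derivative of the distribution function of the maximum, a product of [p]
    and [q] equal factors. Each summand contains a Weibull density, which makes it vanish for
    [t <= 0]. *)
Definition two_block_pdf (p q : nat) (alpha lambda1 lambda t : R) : R :=
  p%:R * weibull_cdf alpha lambda1 t ^+ p.-1 * weibull_pdf alpha lambda1 t *
    weibull_cdf alpha lambda t ^+ q +
  q%:R * weibull_cdf alpha lambda t ^+ q.-1 * weibull_pdf alpha lambda t *
    weibull_cdf alpha lambda1 t ^+ p.

Lemma two_block_pdf_le0 (p q : nat) (alpha lambda1 lambda t : R) : t <= 0 ->
  two_block_pdf p q alpha lambda1 lambda t = 0.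
Proof.
by move=> t0; rewrite /two_block_pdf !weibull_pdf_le0// !mulr0 !mul0r addr0.
Qed.

Lemma has_density_weibull_max (p q : nat) (alpha lambda1 lambda : R)
    (X : 'I_(p + q) -> T -> R) : (0 < p)%N ->
  0 < alpha -> 0 < lambda1 -> 0 < lambda ->
  mutually_independent P X ->
  (forall i, weibull P (X (lshift q i)) alpha lambda1) ->
  (forall j, weibull P (X (rshift p j)) alpha lambda) ->
  has_density P (fun w => vmax (fun i => X i w))
    (two_block_pdf p q alpha lambda1 lambda).
Proof.
move=> p0 al0 l10 l0 indX XL XR.
have pq0 : (0 < p + q)%N by rewrite addn_gt0 p0.
have mX i : measurable_fun setT (X i).
  by rewrite -(splitK i); case: (fintype.split i) => j /=; [case: (XL j)|case: (XR j)].
set Z := fun w => _.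
have mZ : measurable_fun setT Z by exact: measurable_vmax.
pose F (t : R) := weibull_cdf alpha lambda1 t ^+ p * weibull_cdf alpha lambda t ^+ q.
have PZ a : 0 < a -> P (Z @^-1` `]-oo, a[%classic) = (F a)%:E.
  (* Independence over the full index set gives a product, which is then split into the two
     blocks. *)
  move=> a0; rewrite vmax_preimage// indX//.
  under eq_bigl do rewrite inE.
  rewrite big_split_ord/=.
  have PL i := weibull_lt al0 l10 (XL i) a0.
  have PR j := weibull_lt al0 l0 (XR j) a0.
  rewrite /F; move: (weibull_cdf _ _ a) (weibull_cdf _ _ a) PL PR => c1 c PL PR.
  under eq_bigr do rewrite PL.
  under [in X in (_ * X)%E]eq_bigr do rewrite PR.
  by rewrite !prodEFin !prodr_const !card_ord -EFinM.
have dF (t : R) : 0 < t -> is_derive t 1 F (two_block_pdf p q alpha lambda1 lambda t).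
  move=> t0; apply: is_derive_expM; exact: is_derive_weibull_cdf.
have f0 t : 0 <= two_block_pdf p q alpha lambda1 lambda t.
  by rewrite addr_ge0// !mulr_ge0 ?exprn_ge0 ?weibull_cdf_ge0 ?weibull_pdf_ge0.
have cX (g : R -> R) k t : {for t, continuous g} -> {for t, continuous (fun t => g t ^+ k)}.
  by move=> cg; exact: (continuous_comp cg (@exprn_continuous R k (g t))).
have cf : {in `]0, +oo[, continuous (two_block_pdf p q alpha lambda1 lambda)}.
  move=> t t0; have cw1 := continuous_weibull_pdf (alpha := alpha) l10 t0.
  have cw := continuous_weibull_pdf (alpha := alpha) l0 t0.
  have cG1 k := cX _ k _ (continuous_weibull_cdf (alpha := alpha) l10 t0).
  have cG k := cX _ k _ (continuous_weibull_cdf (alpha := alpha) l0 t0).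
  apply: cvgD; apply: cvgM.
  - by apply: cvgM; [apply: cvgM; [exact: cvg_cst|exact: cG1]|exact: cw1].
  - exact: cG.
  - by apply: cvgM; [apply: cvgM; [exact: cvg_cst|exact: cG]|exact: cw].
  - exact: cG1.
have F1 : F t @[t --> +oo] --> (1 : R).
  have cvgX1 l k : 0 < l -> weibull_cdf alpha l t ^+ k @[t --> +oo] --> (1 : R).
    move=> l0'; rewrite -[X in _ --> X](expr1n _ k).
    exact: (cvg_comp _ _ (weibull_cdf_cvg1 al0 l0') (@exprn_continuous R k 1)).
  by rewrite -[X in _ --> X]mulr1; apply: cvgM; exact: cvgX1.
apply: has_density_of_tail => //.
- have mw l := measurable_weibull_pdf alpha l.
  have mG l k := measurable_funX k (measurable_weibull_cdf alpha l).
  apply: measurable_funD; apply: measurable_funM => //;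
  by apply: measurable_funM => //; apply: measurable_funM.
- exact: two_block_pdf_le0.
(* A maximum at most [0] forces the first coordinate, which exists by [p0], to be at most [0]: a
   null event. *)
- apply/eqP; rewrite eq_le measure_ge0 andbT -(weibull_le0 (XL (Ordinal p0))).
  apply: le_measure; rewrite ?inE.
  + exact: measurable_preimage.
  + exact: measurable_preimage.
  + move=> w /=; rewrite !in_itv/= => h; rewrite leNgt; apply/negP => h'.
    have : Z w < X (lshift q (Ordinal p0)) w by exact: le_lt_trans h h'.
    by rewrite vmax_lt// => /forallP/(_ (lshift q (Ordinal p0))); rewrite ltxx.
- move=> a a0; rewrite (tail_integral a0 f0 cf F1 dF).
  + have -> : Z @^-1` `[a, +oo[%classic = ~` (Z @^-1` `]-oo, a[%classic).
      by rewrite preimage_setC setCitvl.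
    by rewrite probability_setC ?PZ//; exact: measurable_preimage.
Qed.

End weibull_maximum.

(** * Monotonicity of the ratio of the two densities *)

Section two_block_ratio.
Context {R : realType}.
Implicit Types (p q : nat) (alpha lambda s t : R).

(** Isolates the factors free of [lambda1], common to both maxima, from the power and the odds
    mixture that make up the ratio. *)
Lemma two_block_pdf_odds p q alpha lambda1 lambda t : (0 < p)%N -> (0 < q)%N ->
  0 < alpha -> 0 < lambda1 -> 0 < lambda -> 0 < t ->
  two_block_pdf p q alpha lambda1 lambda t =
  alpha * t `^ (alpha - 1) * weibull_cdf alpha lambda t ^+ q *
    weibull_cdf alpha lambda1 t ^+ p *
    (p%:R * exp_odds (lambda1 `^ alpha) (t `^ alpha) +
     q%:R * exp_odds (lambda `^ alpha) (t `^ alpha)).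
Proof.
(* With [p] and [q] successors, each density supplies the distribution function missing from the
   lowered power. *)
case: p => // p; case: q => // q _ _ a0 l10 l0 t0.
rewrite /two_block_pdf !weibull_pdf_odds//=.
move: (weibull_cdf _ _ t) (weibull_cdf _ _ t) (exp_odds _ _) (exp_odds _ _).
by move=> G1 G o1 o; rewrite (exprS G) (exprS G1); ring.
Qed.

Lemma two_block_pdf_gt0 p q alpha lambda1 lambda t : (0 < p)%N -> (0 < q)%N ->
  0 < alpha -> 0 < lambda1 -> 0 < lambda -> 0 < t ->
  0 < two_block_pdf p q alpha lambda1 lambda t.
Proof.
move=> p0 q0 a0 l10 l0 t0; rewrite two_block_pdf_odds//.
apply: mulr_gt0.
  by rewrite !mulr_gt0 ?exprn_gt0 ?weibull_cdf_gt0 ?powR_gt0.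
by rewrite addr_gt0// mulr_gt0 ?ltr0n// exp_odds_gt0 ?powR_gt0.
Qed.

(** Multiplies two cross-multiplied ratio inequalities. Unprimed letters belong to the abscissa [s],
    primed ones to [t]; [k] and [k'] are the factors shared by both densities. *)
Lemma ler_mul_cross (k k' c c' a a' x x' y y' : R) :
  0 <= k -> 0 <= k' -> 0 <= c -> 0 <= a' -> 0 <= x -> 0 <= y' ->
  c * a' <= c' * a -> x * y' <= x' * y ->
  (k * c * x) * (k' * a' * y') <= (k' * c' * x') * (k * a * y).
Proof.
move=> k0 k'0 c0 a'0 x0 y'0 hca hxy.
have -> : (k * c * x) * (k' * a' * y') = k * k' * ((c * a') * (x * y')) by ring.
have -> : (k' * c' * x') * (k * a * y) = k * k' * ((c' * a) * (x' * y)) by ring.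
by rewrite ler_wpM2l ?mulr_ge0// ler_pM ?mulr_ge0.
Qed.

Lemma ler_exp_cross n (x y z w : R) : 0 <= x -> 0 <= y -> x * y <= z * w ->
  x ^+ n * y ^+ n <= z ^+ n * w ^+ n.
Proof.
move=> x0 y0 h; have xy0 : 0 <= x * y by exact: mulr_ge0.
by rewrite -!exprMn lerXn2r ?nnegrE// (le_trans xy0).
Qed.

Lemma weibull_cdf_ratio alpha lambda1 lambda1s s t :
  0 < alpha -> 0 < lambda1s -> lambda1s <= lambda1 -> 0 < s -> s <= t ->
  weibull_cdf alpha lambda1s s * weibull_cdf alpha lambda1 t <=
  weibull_cdf alpha lambda1s t * weibull_cdf alpha lambda1 s.
Proof.
move=> a0 c0 ca s0 st.
have [l0 t0] : 0 < lambda1 /\ 0 < t by split; lra.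
rewrite (weibull_cdfE alpha c0 s0) (weibull_cdfE alpha c0 t0).
rewrite (weibull_cdfE alpha l0 s0) (weibull_cdfE alpha l0 t0).
apply: onem_expRN_slope; rewrite ?powR_gt0//.
  by apply: ge0_ler_powR; rewrite ?nnegrE//; lra.
by apply: ge0_ler_powR; rewrite ?nnegrE//; lra.
Qed.

(** The product of [weibull_cdf_ratio] raised to the power [p] and of [exp_odds_mix_ratio], the
    latter taken at the [alpha]-th powers of rates and abscissas. *)
Lemma two_block_pdf_ratio p q alpha lambda lambda1 lambda1s s t :
  (0 < p)%N -> (0 < q)%N -> 0 < alpha -> 0 < lambda1s ->
  lambda1s <= lambda1 -> lambda1s <= lambda -> 0 < s -> s <= t ->
  two_block_pdf p q alpha lambda1s lambda s *
    two_block_pdf p q alpha lambda1 lambda t <=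
  two_block_pdf p q alpha lambda1s lambda t *
    two_block_pdf p q alpha lambda1 lambda s.
Proof.
move=> p0 q0 a0 c0 ca cb s0 st.
have [a10 b0 t0] : [/\ 0 < lambda1, 0 < lambda & 0 < t] by split; lra.
have pow x y : 0 < x -> x <= y -> x `^ alpha <= y `^ alpha.
  move=> x0 xy; apply: ge0_ler_powR => //; rewrite ?nnegrE; lra.
rewrite (two_block_pdf_odds p0 q0 a0 c0 b0 s0) (two_block_pdf_odds p0 q0 a0 c0 b0 t0).
rewrite (two_block_pdf_odds p0 q0 a0 a10 b0 s0) (two_block_pdf_odds p0 q0 a0 a10 b0 t0).
have odds := exp_odds_mix_ratio p q (powR_gt0 alpha c0) (pow _ _ c0 ca)
  (pow _ _ c0 cb) (powR_gt0 alpha s0) (pow _ _ s0 st).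
have cdfX := ler_exp_cross p (weibull_cdf_ge0 _ _ _) (weibull_cdf_ge0 _ _ _)
  (weibull_cdf_ratio a0 c0 ca s0 st).
have K0 x : 0 <= alpha * x `^ (alpha - 1) * weibull_cdf alpha lambda x ^+ q.
  by rewrite !mulr_ge0 ?powR_ge0 ?exprn_ge0 ?weibull_cdf_ge0// ltW.
have odds_ge0 l x : 0 < l -> 0 < x ->
    0 <= p%:R * exp_odds (l `^ alpha) (x `^ alpha) +
         q%:R * exp_odds (lambda `^ alpha) (x `^ alpha).
  move=> hl hx; have := exp_odds_gt0 (powR_gt0 alpha hl) (powR_gt0 alpha hx).
  have := exp_odds_gt0 (powR_gt0 alpha b0) (powR_gt0 alpha hx).
  by move=> /ltW h1 /ltW h2; exact: addr_ge0 (mulr_ge0 _ h2) (mulr_ge0 _ h1).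
apply: ler_mul_cross cdfX odds; [exact: K0|exact: K0| | | |].
- exact: exprn_ge0 (weibull_cdf_ge0 _ _ _).
- exact: exprn_ge0 (weibull_cdf_ge0 _ _ _).
- exact: odds_ge0.
- exact: odds_ge0.
Qed.

Lemma lee_div_EFin (x y z w : R) : 0 < y -> 0 < w -> x * w <= z * y ->
  (x%:E / y%:E <= z%:E / w%:E)%E.
Proof.
move=> y0 w0 h; rewrite !inver !gt_eqF// -!EFinM lee_fin.
by rewrite ler_pdivrMr// mulrAC ler_pdivlMr.
Qed.

End two_block_ratio.

Unset Implicit Arguments.

Theorem theorem4p13 (R : realType) (p q : nat) (hp : (1 <= p)%N)
  (hq : (1 <= q)%N) (alpha lambda lambda1 lambda1s : R)
  (halpha : 0 < alpha) (hlambda : 0 < lambda) (hlambda1 : 0 < lambda1)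
  (hlambda1s : 0 < lambda1s)
  (d : measure_display) (T : measurableType d) (P : probability T R)
  (X : 'I_(p + q) -> {RV P >-> R})
  (X_indep : mutually_independent P (fun i => X i : T -> R))
  (X_left : forall i : 'I_p, weibull P (X (lshift q i)) alpha lambda1)
  (X_right : forall j : 'I_q, weibull P (X (rshift p j)) alpha lambda)
  (d' : measure_display) (T' : measurableType d') (P' : probability T' R)
  (Y : 'I_(p + q) -> {RV P' >-> R})
  (Y_indep : mutually_independent P' (fun i => Y i : T' -> R))
  (Y_ge0 : forall i, {ae P', forall w, 0 <= Y i w})
  (Y_left : forall i : 'I_p, weibull P' (Y (lshift q i)) alpha lambda1s)
  (Y_right : forall j : 'I_q, weibull P' (Y (rshift p j)) alpha lambda)
  (hmin : lambda1s = Num.min lambda (Num.min lambda1 lambda1s)) :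
  weak_majorized
    (row_mx (const_mx lambda1 : 'rV[R]_p) (const_mx lambda : 'rV[R]_q))
    (row_mx (const_mx lambda1s : 'rV[R]_p) (const_mx lambda : 'rV[R]_q)) ->
  lr_le [set t : R | 0 < t]
    P (fun w => vmax (fun i => X i w))
    P' (fun w => vmax (fun i => Y i w)).

Proof.
move=> _.
have [cb ca] : lambda1s <= lambda /\ lambda1s <= lambda1.
  split; rewrite hmin; first by rewrite ge_min lexx.
  by rewrite !ge_min lexx orbT.
(* These versions are positive for [0 < t] and zero elsewhere, so the ratio is well defined exactly
   on the required set. *)
exists (two_block_pdf p q alpha lambda1 lambda),
       (two_block_pdf p q alpha lambda1s lambda); split.
- exact: (has_density_weibull_max (X := X) hp halpha hlambda1 hlambda
    X_indep X_left X_right).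
- exact: (has_density_weibull_max (X := Y) hp halpha hlambda1s hlambda
    Y_indep Y_left Y_right).
- apply/seteqP; split => t /=.
    by move=> t0; left; rewrite gt_eqF// two_block_pdf_gt0.
  by case=> h; rewrite ltNge; apply/negP => t0; rewrite two_block_pdf_le0// eqxx in h.
- move=> s t /= s0 t0 st.
  have f0 x : 0 < x -> 0 < two_block_pdf p q alpha lambda1 lambda x.
    by move=> x0; exact: two_block_pdf_gt0.
  apply: (lee_div_EFin (f0 s s0) (f0 t t0)).
  exact: two_block_pdf_ratio.
Qed.
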